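(* The following problem, called the 2DST reachability problem, is undecidable: given a two-way deterministic data string transducer (2DST) $S$ and a state $q$ of $S$, determine whether there exists a data string $w$ such that $S$ enters the state $q$ while processing $w$.
   Context: Fix a data domain $D$, that is, a totally ordered, possibly infinite, set of data values, with strict total order $<$. For a finite set $\Sigma$ of tags, a data string over $\Sigma$ is a finite sequence of pairs in $\Sigma\times D$. A (deterministic) streaming data-string transducer (SDST) $S$ from a finite input alphabet $\Sigma$ to a finite output alphabet $\Gamma$ consists of: a finite set $Q$ of states; an initial state $q_0\in Q$; a finite set $V$ of data variables with a distinguished $curr\in V$ (used to refer to the data value of the current input symbol); a finite set $X$ of data string variables; a partial output function $O$ from $Q$ to $((\Gamma\times V)\cup X)^*$; and a finite set $E$ of transitions $(q,\sigma,\varphi,q',\alpha)$ with $q,q'\in Q$, $\sigma\in\Sigma$, $\varphi$ a Boolean formula over atoms $v<curr$ and $curr<v$ ($v\in V$), and $\alpha$ an assignment mapping $V$ to $V$ and $X$ to $((\Gamma\times V)\cup X)^*$. It is required that (1) each $x\in X$ occurs at most once in each $O(q)$; (2) for each transition, each $x\in X$ occurs at most once in total in the strings $\{\alpha(y)\mid y\in X\}$; (3) for any two distinct transitions with the same source state and the same input tag, the conjunction of their tests is unsatisfiable. A valuation $\beta$ is a partial function sending data variables to $D$ and data string variables to data strings over $\Gamma$; initially all data variables are undefined and all data string variables are the empty string. In a configuration $(q,\beta)$, when reading a symbol $(\sigma,d)$, one sets $\beta'=\beta[curr\mapsto d]$; a transition $(q,\sigma,\varphi,q',\alpha)$ is enabled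 if all variables of $\varphi$ are defined in $\beta'$ and $\varphi$ is true under $\beta'$; the successor configuration is $(q',\beta'')$, where $\beta''(z)$ is the value of $\alpha(z)$ under $\beta'$ (undefined if $\alpha(z)$ contains an undefined variable). A two-way (deterministic) data string transducer (2DST) is the extension of this model in which at each step the transducer can decide whether to move left, move right, or stay put: transitions are tuples $(q,\sigma,\varphi,q',\alpha,\zeta)$ with $q,\sigma,\varphi,q',\alpha$ as for SDSTs and $\zeta\in\{\leftarrow,\downarrow,\rightarrow\}$ the head move. The input data string is enclosed by two special symbols $\vdash$ (left) and $\dashv$ (right), which may also appear as tags in transitions. The head starts at the left end of the input. The machine has final states and stops when it reaches a final state; if it never reaches a final state, or tries to move left when the tag is $\vdash$ or right when the tag is $\dashv$, the output is undefined.
   Formalization: The data domain D is assumed infinite; for a fixed finite D the transducer acts as a two-way finite automaton over the alphabet Σ×D, so the reachability problem is decidable and the claim fails. *)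

(* Defs.v *)
From Stdlib Require List.
From Stdlib Require Import Cantor Relation_Operators.
From HB Require Import structures.
From mathcomp Require Import all_boot all_order.
From mathcomp Require Import classical_sets cardinality.

Set Implicit Arguments.
Unset Strict Implicit.
Unset Printing Implicit Defensive.

(** * Two-way data string transducers *)

Inductive tag (Sig : Type) := LEnd | REnd | Sym of Sig.
Arguments LEnd {Sig}.
Arguments REnd {Sig}.

Inductive move := MLeft | MStay | MRight.

(* [FLtCurr v] is the atom v < curr and [FGtCurr v] is the atom curr < v. *)
Inductive fml (V : Type) :=
| FTrue
| FLtCurr of V
| FGtCurr of V
| FNot of fml V
| FAnd of fml V & fml V
| FOr of fml V & fml V.
Arguments FTrue {V}.

Record trans (Sig Gam Q V X : finType) := Trans {
  t_src : Q;
  t_tag : tag Sig;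
  t_test : fml V;
  t_dst : Q;
  t_dvar : {ffun V -> V};
  t_svar : {ffun X -> seq (Gam * V + X)};
  t_move : move }.

Record pre2dst (Sig Gam Q V X : finType) := Pre2DST {
  init : Q;
  curr : V;
  final : {set Q};
  out : {ffun Q -> option (seq (Gam * V + X))};
  delta : seq (trans Sig Gam Q V X) }.

Record valuation (d : Order.disp_t) (D : orderType d) (Gam V X : finType) :=
  Valuation {
    dval : {ffun V -> option D};
    sval : {ffun X -> option (seq (Gam * D))} }.

Record config (d : Order.disp_t) (D : orderType d) (Gam Q V X : finType) :=
  Config {
    c_state : Q;
    c_pos : nat;
    c_val : valuation D Gam V X }.

Section Semantics.
Context {d : Order.disp_t} (D : orderType d) {Sig Gam Q V X : finType}.

(* [None] means that some variable occurring in the formula is undefined. *)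
Fixpoint fml_eval (c : V) (b : {ffun V -> option D}) (phi : fml V) :
    option bool :=
  match phi with
  | FTrue => Some true
  | FLtCurr v =>
      if (b v, b c) is (Some x, Some y) then Some (x < y)%O else None
  | FGtCurr v =>
      if (b v, b c) is (Some x, Some y) then Some (y < x)%O else None
  | FNot p => omap negb (fml_eval c b p)
  | FAnd p q =>
      if (fml_eval c b p, fml_eval c b q) is (Some x, Some y)
      then Some (x && y) else None
  | FOr p q =>
      if (fml_eval c b p, fml_eval c b q) is (Some x, Some y)
      then Some (x || y) else None
  end.

Definition unsatisfiable (c : V) (phi : fml V) : Prop :=
  forall b : {ffun V -> option D}, fml_eval c b phi <> Some true.

Fixpoint str_eval (b : valuation D Gam V X) (s : seq (Gam * V + X)) :
    option (seq (Gam * D)) :=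
  match s with
  | [::] => Some [::]
  | inl (g, v) :: s' =>
      if (dval b v, str_eval b s') is (Some x, Some u)
      then Some ((g, x) :: u) else None
  | inr y :: s' =>
      if (sval b y, str_eval b s') is (Some u, Some u')
      then Some (u ++ u') else None
  end.

Definition occ (x : X) (s : seq (Gam * V + X)) : nat := count_mem (inr x) s.

Record is_2dst (S : pre2dst Sig Gam Q V X) : Prop := Is2DST {
  out_copyless : forall q s x, out S q = Some s -> occ x s <= 1;
  delta_copyless : forall t x, List.In t (delta S) ->
    \sum_(y : X) occ x (t_svar t y) <= 1;
  delta_deterministic : forall t t',
    List.In t (delta S) -> List.In t' (delta S) -> t <> t' ->
    t_src t = t_src t' -> t_tag t = t_tag t' ->
    unsatisfiable (curr S) (FAnd (t_test t) (t_test t')) }.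

(* The enclosing symbols occupy positions 0 and |w| + 1 and carry no data
   value. *)
Definition tape (w : seq (Sig * D)) : seq (tag Sig * option D) :=
  (LEnd, None) ::
    rcons [seq (Sym a.1, Some a.2) | a <- w] (REnd, None).

(* On an enclosing symbol ([x = None]), curr becomes undefined. *)
Definition read (S : pre2dst Sig Gam Q V X) (x : option D)
    (b : valuation D Gam V X) : valuation D Gam V X :=
  Valuation [ffun v => if v == curr S then x else dval b v] (sval b).

Definition assign (t : trans Sig Gam Q V X) (b : valuation D Gam V X) :
    valuation D Gam V X :=
  Valuation [ffun v => dval b (t_dvar t v)]
            [ffun y => str_eval b (t_svar t y)].

Definition move_head (a : tag Sig) (m : move) (i : nat) : option nat :=
  match a, m with
  | LEnd, MLeft | REnd, MRight => None
  | _, MLeft => Some i.-1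
  | _, MStay => Some i
  | _, MRight => Some i.+1
  end.

(* No step leaves a final state, and a move off the tape is not a step. *)
Inductive step (S : pre2dst Sig Gam Q V X) (w : seq (Sig * D)) :
    config D Gam Q V X -> config D Gam Q V X -> Prop :=
| Step (t : trans Sig Gam Q V X) (i j : nat) (x : option D)
    (b : valuation D Gam V X) :
    List.In t (delta S) ->
    t_src t \notin final S ->
    onth (tape w) i = Some (t_tag t, x) ->
    fml_eval (curr S) (dval (read S x b)) (t_test t) = Some true ->
    move_head (t_tag t) (t_move t) i = Some j ->
    step S w (Config (t_src t) i b)
             (Config (t_dst t) j (assign t (read S x b))).

Definition init_config (S : pre2dst Sig Gam Q V X) : config D Gam Q V X :=
  Config (init S) 0 (Valuation [ffun=> None] [ffun=> Some [::]]).

Definition enters (S : pre2dst Sig Gam Q V X) (w : seq (Sig * D)) (q : Q) :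
    Prop :=
  exists2 c, clos_refl_trans _ (step S w) (init_config S) c & c_state c = q.

End Semantics.

Arguments is_2dst {d} D {Sig Gam Q V X} S.

Record instance (d : Order.disp_t) (D : orderType d) := Instance {
  i_Sig : finType;
  i_Gam : finType;
  i_Q : finType;
  i_V : finType;
  i_X : finType;
  i_2dst : pre2dst i_Sig i_Gam i_Q i_V i_X;
  i_target : i_Q;
  i_valid : is_2dst D i_2dst }.

Definition reachable (d : Order.disp_t) (D : orderType d) (I : instance D) :
    Prop :=
  exists w : seq (i_Sig I * D), enters (i_2dst I) w (i_target I).

(** * Partial recursive functions

    Unary presentation: several arguments are packed with the Cantor pairing
    function. *)

Definition pr (a b : nat) : nat := Cantor.to_nat (a, b).
Arguments pr : simpl never.

Inductive prec :=
| RZero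
| RSucc
| RFst
| RSnd
| RPair of prec & prec
| RComp of prec & prec
| RRec of prec & prec
| RMu of prec.

(* [computes p a b]: the partial function denoted by [p] is defined at [a],
   with value [b]. *)
Inductive computes : prec -> nat -> nat -> Prop :=
| CZero a : computes RZero a 0
| CSucc a : computes RSucc a a.+1
| CFst a b : computes RFst (pr a b) a
| CSnd a b : computes RSnd (pr a b) b
| CPair f g a b c :
    computes f a b -> computes g a c -> computes (RPair f g) a (pr b c)
| CComp f g a b c :
    computes g a b -> computes f b c -> computes (RComp f g) a c
| CRec0 f g a b : computes f a b -> computes (RRec f g) (pr a 0) b
| CRecS f g a n b c :
    computes (RRec f g) (pr a n) b -> computes g (pr a (pr n b)) c ->
    computes (RRec f g) (pr a n.+1) c
| CMu f a n (k : nat -> nat) :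
    computes f (pr a n) 0 ->
    (forall m, m < n -> computes f (pr a m) (k m).+1) ->
    computes (RMu f) a n.

(* [p] only has to answer on codes of instances. *)
Definition decidable_problem (I : Type) (code : I -> nat) (P : I -> Prop) :
    Prop :=
  exists p : prec, forall i : I,
    exists2 b : bool, computes p (code i) (nat_of_bool b) & (P i <-> b).

Definition undecidable (I : Type) (code : I -> nat) (P : I -> Prop) : Prop :=
  ~ decidable_problem code P.

(** * Coding of transducers

    Elements of a finite set are coded by their rank in its enumeration. *)

Definition code_fin (T : finType) (x : T) : nat := enum_rank x.

Fixpoint code_seq (T : Type) (c : T -> nat) (s : seq T) : nat :=
  if s is x :: s' then (pr (c x) (code_seq c s')).+1 else 0.

Definition code_opt (T : Type) (c : T -> nat) (o : option T) : nat :=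
  if o is Some x then (c x).+1 else 0.

Definition code_ffun (A : finType) (T : Type) (c : T -> nat)
    (f : {ffun A -> T}) : nat :=
  code_seq (fun a => c (f a)) (enum A).

Definition code_tag (Sig : finType) (a : tag Sig) : nat :=
  match a with
  | LEnd => 0
  | REnd => 1
  | Sym s => (code_fin s).+2
  end.

Definition code_move (m : move) : nat :=
  match m with MLeft => 0 | MStay => 1 | MRight => 2 end.

Fixpoint code_fml (V : finType) (phi : fml V) : nat :=
  match phi with
  | FTrue => pr 0 0
  | FLtCurr v => pr 1 (code_fin v)
  | FGtCurr v => pr 2 (code_fin v)
  | FNot p => pr 3 (code_fml p)
  | FAnd p q => pr 4 (pr (code_fml p) (code_fml q))
  | FOr p q => pr 5 (pr (code_fml p) (code_fml q))
  end.

Definition code_item (Gam V X : finType) (z : Gam * V + X) : nat :=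
  match z with
  | inl (g, v) => pr 0 (pr (code_fin g) (code_fin v))
  | inr x => pr 1 (code_fin x)
  end.

Definition code_trans (Sig Gam Q V X : finType) (t : trans Sig Gam Q V X) :
    nat :=
  pr (code_fin (t_src t)) (
  pr (code_tag (t_tag t)) (
  pr (code_fml (t_test t)) (
  pr (code_fin (t_dst t)) (
  pr (code_ffun (@code_fin V) (t_dvar t)) (
  pr (code_ffun (code_seq (@code_item Gam V X)) (t_svar t))
     (code_move (t_move t))))))).

Definition code_pre2dst (Sig Gam Q V X : finType)
    (S : pre2dst Sig Gam Q V X) : nat :=
  pr (code_fin (init S)) (
  pr (code_fin (curr S)) (
  pr (code_seq (@code_fin Q) (enum (final S))) (
  pr (code_ffun (code_opt (code_seq (@code_item Gam V X))) (out S))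
     (code_seq (@code_trans Sig Gam Q V X) (delta S))))).

Definition code_instance (d : Order.disp_t) (D : orderType d)
    (I : instance D) : nat :=
  pr #|i_Sig I| (
  pr #|i_Gam I| (
  pr #|i_Q I| (
  pr #|i_V I| (
  pr #|i_X I| (
  pr (code_pre2dst (i_2dst I)) (code_fin (i_target I))))))).

(* Main.v *)
(* Data variables that point into a strictly increasing input are counters: a
   scan from the left end increments one, decrements one or tests it for zero.
   So a while program on finitely many registers is run by a transducer, on
   every input that is long enough, and every partial recursive function is
   computed by such a program.

   Undecidability follows by diagonalisation, without a universal program. To a
   program [c] and a number [n] we associate a transducer that loads [n] into
   register 0, runs [c], and enters the target state iff [c] returns 0; its
   code is a primitive recursive function [reduction] of [n] if [n] itself
   stores the part of the code that does not depend on [n]. If [p] decides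
   reachability, take for [c] the program that computes [p] after [reduction]:
   its transducer reaches the target iff [p] answers that it does not. As [p]
   answers on every instance, only terminating runs have to be simulated. *)

Require Import Defs.
From mathcomp Require Import all_boot all_order.
From mathcomp Require Import classical_sets cardinality.
From Stdlib Require List.
From Stdlib Require Import Cantor Relation_Operators Operators_Properties.
From mathcomp Require Import boolp zify.

Set Implicit Arguments.
Unset Strict Implicit.
Unset Printing Implicit Defensive.

(** * Triangular numbers and the Cantor pairing *)

Definition tri (n : nat) : nat := nat_rec _ 0 (fun i m => i.+1 + m) n.

(** Holds by conversion: [tri] uses the recursor to which [Cantor.to_nat] unfolds. *)
Lemma prE a b : pr a b = b + tri (b + a).
Proof. by []. Qed.

(** With [pr_succ_0], this describes the successor of a pair: one step along an antidiagonal, or a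
    jump from its end to the start of the next one. The loop of [unpair_cmd] follows this walk. *)
Lemma pr_succ_l a b : pr a b.+1 = (pr a.+1 b).+1.
Proof. by rewrite !prE addSn addnS. Qed.

Lemma pr_succ_0 b : pr b.+1 0 = (pr 0 b).+1.
Proof. by rewrite !prE !add0n !addn0 /= addSn. Qed.

Definition unl (n : nat) : nat := (Cantor.of_nat n).1.
Definition unr (n : nat) : nat := (Cantor.of_nat n).2.

Lemma unlK a b : unl (pr a b) = a.
Proof. by rewrite /unl /pr cancel_of_to. Qed.

Lemma unrK a b : unr (pr a b) = b.
Proof. by rewrite /unr /pr cancel_of_to. Qed.

Lemma pr_un n : n = pr (unl n) (unr n).
Proof. by rewrite /pr /unl /unr -surjective_pairing cancel_to_of. Qed.

Lemma pr_inj a b a' b' : pr a b = pr a' b' -> a = a' /\ b = b'.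
Proof. by move=> e; rewrite -(unlK a b) -{2}(unrK a b) e unlK unrK. Qed.

(** * While programs *)

Inductive cmd :=
| Inc of nat
| Dec of nat
| Zero of nat
| Copy of nat & nat
| Seq of cmd & cmd
| If of nat & cmd & cmd
| While of nat & cmd.

Definition store := nat -> nat.

Definition upd (s : store) (r n : nat) : store :=
  fun r' => if r' == r then n else s r'.

(* [N] bounds the values reached by increments: it tells how long an input the
   transducer needs in order to simulate the execution. *)
Inductive exec (N : nat) : cmd -> store -> store -> Prop :=
| EInc r s : s r < N -> exec N (Inc r) s (upd s r (s r).+1)
| EDec r s : exec N (Dec r) s (upd s r (s r).-1)
| EZero r s : exec N (Zero r) s (upd s r 0)
| ECopy r r' s : exec N (Copy r r') s (upd s r (s r'))
| ESeq c1 c2 s s1 s2 :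
    exec N c1 s s1 -> exec N c2 s1 s2 -> exec N (Seq c1 c2) s s2
| EIfT r c1 c2 s s' : s r != 0 -> exec N c1 s s' -> exec N (If r c1 c2) s s'
| EIfF r c1 c2 s s' : s r = 0 -> exec N c2 s s' -> exec N (If r c1 c2) s s'
| EWhileT r c s s1 s2 :
    s r != 0 -> exec N c s s1 -> exec N (While r c) s1 s2 ->
    exec N (While r c) s s2
| EWhileF r c s : s r = 0 -> exec N (While r c) s s.

Lemma exec_mono N N' c s s' : N <= N' -> exec N c s s' -> exec N' c s s'.
Proof.
move=> le; elim=> *; [|by econstructor; eauto..].
by constructor; lia.
Qed.

Definition wp (c : cmd) (Q : store -> Prop) (s : store) : Prop :=
  exists N s', exec N c s s' /\ Q s'.

Lemma wp_Inc r (Q : store -> Prop) s : Q (upd s r (s r).+1) -> wp (Inc r) Q s.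
Proof. by exists (s r).+1, (upd s r (s r).+1); split=> //; constructor. Qed.

Lemma wp_Dec r (Q : store -> Prop) s : Q (upd s r (s r).-1) -> wp (Dec r) Q s.
Proof. by exists 0, (upd s r (s r).-1); split=> //; constructor. Qed.

Lemma wp_Zero r (Q : store -> Prop) s : Q (upd s r 0) -> wp (Zero r) Q s.
Proof. by exists 0, (upd s r 0); split=> //; constructor. Qed.

Lemma wp_Copy r r' (Q : store -> Prop) s :
  Q (upd s r (s r')) -> wp (Copy r r') Q s.
Proof. by exists 0, (upd s r (s r')); split=> //; constructor. Qed.

Lemma wp_Seq c1 c2 Q s : wp c1 (wp c2 Q) s -> wp (Seq c1 c2) Q s.
Proof.
move=> [N1 [s1 [e1 [N2 [s2 [e2 q]]]]]]; exists (maxn N1 N2), s2; split=> //.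
by apply: ESeq (exec_mono _ e1) (exec_mono _ e2); lia.
Qed.

Lemma wp_If r c1 c2 Q s :
  (s r != 0 -> wp c1 Q s) -> (s r = 0 -> wp c2 Q s) -> wp (If r c1 c2) Q s.
Proof.
move=> h1 h2; have [z|z] := eqVneq (s r) 0.
  have [N [s' [e q]]] := h2 z.
  by exists N, s'; split=> //; apply: EIfF.
have [N [s' [e q]]] := h1 z.
by exists N, s'; split=> //; apply: EIfT.
Qed.

Lemma wp_mono c (Q Q' : store -> Prop) s :
  wp c Q s -> (forall s', Q s' -> Q' s') -> wp c Q' s.
Proof. by move=> [N [s' [e q]]] h; exists N, s'; split=> //; apply: h. Qed.

(** The index of [I] is the exact number of iterations left, so [I] serves as invariant and variant
    at once. *)
Lemma wp_While r c (I : nat -> store -> Prop) (Q : store -> Prop) n s :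
  (forall i s, I i.+1 s -> s r != 0 /\ wp c (I i) s) ->
  (forall s, I 0 s -> s r = 0 /\ Q s) ->
  I n s -> wp (While r c) Q s.
Proof.
move=> hS h0; elim: n s => [|n IH] s.
  by move/h0=> [sr q]; exists 0, s; split=> //; apply: EWhileF.
move/hS=> [sr [N1 [s1 [e1 /IH [N2 [s2 [e2 q]]]]]]].
exists (maxn N1 N2), s2; split=> //.
by apply: EWhileT sr (exec_mono _ e1) (exec_mono _ e2); lia.
Qed.

Ltac wpstep := first
  [ apply: wp_Seq | apply: wp_Inc | apply: wp_Dec | apply: wp_Zero
  | apply: wp_Copy ].

Ltac updsimpl := rewrite /upd; repeat match goal with
  |- context [@eq_op _ ?a ?b] =>
    first [ have -> : (a == b) = true by lia
          | have -> : (a == b) = false by lia ]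
  end.
Ltac updlia := updsimpl; lia.

(** * Compilation of partial recursive functions into while programs *)

Definition keep (x : nat) (s s' : store) := forall y, y < x -> s' y = s y.

(** The arguments [a] and [b] are in [x.+1] and [x.+2]. The first loop adds [b] to both [x] and
    [x.+1]; the second adds to [x] each number from [b + a] down to 1, that is, [tri (b + a)]. *)
Definition pair_cmd (x : nat) : cmd :=
  Seq (Zero x) (Seq
   (While x.+2 (Seq (Dec x.+2) (Seq (Inc x.+1) (Inc x))))
   (While x.+1 (Seq (Copy x.+2 x.+1) (Seq
     (While x.+2 (Seq (Dec x.+2) (Inc x)))
     (Dec x.+1))))).

Lemma pair_cmdP x s :
  wp (pair_cmd x)
    (fun s' => s' x = pr (s x.+1) (s x.+2) /\ keep x s s') s.
Proof.
set a := s x.+1; set b := s x.+2.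
do 2 wpstep; apply: wp_Seq.
apply: (wp_While (n := b) (I := fun i s' => [/\ s' x.+2 = i,
  s' x.+1 + i = b + a, s' x + i = b & keep x s s'])).
- move=> i s' [h1 h2 h3 h4]; split; first by rewrite h1.
  do 5 wpstep; split; last (move=> y hy; rewrite -(h4 y hy)); updlia.
- move=> s1 [h1 h2 h3 h4]; split=> //.
  apply: (wp_While (n := b + a) (I := fun i s' => [/\ s' x.+1 = i,
    s' x + tri i = pr a b & keep x s s'])).
  + move=> i s' [k1 k2 k4]; split; first by rewrite k1.
    do 3 wpstep.
    apply: (wp_While (n := i.+1) (I := fun j s' => [/\ s' x.+2 = j,
      s' x.+1 = i.+1, s' x + j + tri i = pr a b & keep x s s'])).
    * move=> j t [l1 l2 l3 l4]; split; first by rewrite l1.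
      do 3 wpstep; split; last (move=> y hy; rewrite -(l4 y hy)); updlia.
    * move=> t [l1 l2 l3 l4]; split=> //.
      wpstep; split; last (move=> y hy; rewrite -(l4 y hy)); updlia.
    * split; try updlia; first by rewrite /= in k2; updlia.
      by move=> y hy; rewrite -(k4 y hy); updlia.
  + move=> s' [k1 /= k2 k4]; rewrite addn0 in k2; by split.
  + split=> //; first by lia.
    by rewrite prE; lia.
- split; try updlia.
  by move=> y hy; updlia.
Qed.

(** Starts from the pair of zeros, whose code is 0, and takes as many successor steps in the Cantor
    enumeration as register [x] says. *)
Definition unpair_cmd (x : nat) : cmd :=
  Seq (Zero x.+1) (Seq (Zero x.+2)
   (While x (Seq (Dec x)
     (If x.+1 (Seq (Dec x.+1) (Inc x.+2))
              (Seq (Inc x.+2) (Seq (Copy x.+1 x.+2) (Zero x.+2))))))).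

Lemma unpair_cmdP x a b s : s x = pr a b ->
  wp (unpair_cmd x)
    (fun s' => [/\ s' x.+1 = a, s' x.+2 = b & keep x s s']) s.
Proof.
move=> sx; do 4 wpstep.
apply: (wp_While (n := pr a b) (I := fun i s' => [/\ s' x = i,
  pr (s' x.+1) (s' x.+2) + i = pr a b & keep x s s'])).
- move=> i s' [h1 h2 h3]; split; first by rewrite h1.
  do 2 wpstep.
  have h3' y : y < x -> s y = upd s' x (s' x).-1 y.
    by move=> hy; rewrite -(h3 y hy); updlia.
  apply: wp_If => h.
  + do 3 wpstep; split; last (move=> y hy; rewrite (h3' y hy)); try updlia.
    move: h h2; updsimpl.
    case: (s' x.+1) => // m _ /=.
    rewrite pr_succ_l; lia.
  + do 5 wpstep; split; last (move=> y hy; rewrite (h3' y hy)); try updlia.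
    move: h h2; updsimpl.
    by move=> ->; rewrite pr_succ_0; lia.
- by move=> s' [h1]; rewrite addn0 => /pr_inj [-> ->] h3; split.
- split; last by move=> y hy; updlia.
  + by updsimpl.
  + by updsimpl; rewrite prE.
Qed.

(* Input and output are in register [x]; the registers below [x] are left
   unchanged, those above are scratch. *)
Fixpoint compile (f : prec) (x : nat) : cmd :=
  match f with
  | RZero => Zero x
  | RSucc => Inc x
  | RFst => Seq (unpair_cmd x) (Copy x x.+1)
  | RSnd => Seq (unpair_cmd x) (Copy x x.+2)
  | RPair f g =>
      Seq (Copy x.+1 x) (Seq (compile f x.+1) (Seq (Copy x.+2 x)
       (Seq (compile g x.+2) (pair_cmd x))))
  | RComp f g => Seq (compile g x) (compile f x)
  | RRec f g =>
      Seq (unpair_cmd x) (Seq (Zero x.+3) (Seq (Copy x.+4 x.+1)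
       (Seq (compile f x.+4) (Seq
         (While x.+2 (Seq (Dec x.+2)
           (Seq (Copy x.+4.+2 x.+3) (Seq (Copy x.+4.+3 x.+4)
           (Seq (pair_cmd x.+4.+1) (Seq (Copy x.+4.+2 x.+4.+1)
           (Seq (Copy x.+4.+1 x.+1) (Seq (pair_cmd x.+4)
           (Seq (compile g x.+4) (Inc x.+3))))))))))
         (Copy x x.+4)))))
  | RMu f =>
      let eval := Seq (Copy x.+3 x) (Seq (Copy x.+4 x.+1)
                    (Seq (pair_cmd x.+2) (compile f x.+2))) in
      Seq (Zero x.+1) (Seq eval
        (Seq (While x.+2 (Seq (Inc x.+1) eval)) (Copy x x.+1)))
  end.

Lemma computes_rec_inv f g z b : computes (RRec f g) z b ->
  (exists2 a, z = pr a 0 & computes f a b) \/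
  (exists a n c, [/\ z = pr a n.+1, computes (RRec f g) (pr a n) c
    & computes g (pr a (pr n c)) b]).
Proof.
move=> h; inversion h; subst; first by left; exists a.
by right; exists a, n, b0.
Qed.

(** Unrolls the recursion into the sequence of accumulators, so that the invariant of the compiled
    loop can name them. *)
Lemma computes_rec_seq f g a n b : computes (RRec f g) (pr a n) b ->
  exists acc : nat -> nat, [/\ computes f a (acc 0), acc n = b
    & forall i, i < n -> computes g (pr a (pr i (acc i))) (acc i.+1)].
Proof.
elim: n b => [|n IH] b /computes_rec_inv [[a' e h]|[a' [m [c [e h1 h2]]]]].
- by move: (pr_inj e) h => [-> _]; exists (fun=> b); split.
- by move: (pr_inj e) => [].
- by move: (pr_inj e) => [].
- move: (pr_inj e) h1 h2 => [<- [<-]] /IH[acc [a0 an aS]] h2.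
  exists (fun i => if i == n.+1 then b else acc i); rewrite eqxx; split=> // i.
  rewrite ltnS leq_eqVlt eqSS => /orP[/eqP->|ltin].
    by rewrite eqxx ltn_eqF // an.
  by rewrite !ltn_eqF //; [exact: aS | lia].
Qed.

Lemma compileP f a b x s : computes f a b -> s x = a ->
  wp (compile f x) (fun s' => s' x = b /\ keep x s s') s.
Proof.
elim: f a b x s => [||||f IHf g IHg|f IHf g IHg|f IHf g IHg|f IHf] a b x s h sx.
- inversion h; subst; wpstep; split; first updlia.
  by move=> y hy; updlia.
- inversion h; subst; wpstep; split; first updlia.
  by move=> y hy; updlia.
- move: sx; inversion h; subst=> sx; wpstep; apply: wp_mono (unpair_cmdP sx) _.
  move=> s1 [h1 h2 h3]; wpstep; split; first updlia.
  by move=> y hy; rewrite -(h3 y hy); updlia.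
- move: sx; inversion h; subst=> sx; wpstep; apply: wp_mono (unpair_cmdP sx) _.
  move=> s1 [h1 h2 h3]; wpstep; split; first updlia.
  by move=> y hy; rewrite -(h3 y hy); updlia.
- inversion h as [| | | |f' g' a' b1 b2 hf hg e1 e2 e3| | | |]; subst.
  do 3 wpstep; apply: wp_mono; first by apply: (IHf _ _ _ _ hf); updlia.
  move=> s1 [h1 k1]; do 3 wpstep.
  apply: wp_mono.
    by apply: (IHg _ _ _ _ hg); updsimpl; rewrite k1 //; updlia.
  move=> s2 [h2 k2]; apply: wp_mono (pair_cmdP _ _) _ => s3 [-> k3].
  rewrite h2 k2 //; split; first by updsimpl; rewrite h1.
  move=> y hy; rewrite k3 // k2; last by lia.
  by updsimpl; rewrite k1; updlia.
- inversion h as [| | | | |f' g' a' b1 b2 hg hf e1 e2 e3| | |]; subst.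
  wpstep; apply: wp_mono; first exact: (IHg _ _ _ _ hg).
  move=> s1 [h1 k1]; apply: wp_mono; first exact: (IHf _ _ _ _ hf).
  by move=> s2 [h2 k2]; split=> // y hy; rewrite k2 // k1.
- rewrite (pr_un a) in h sx; move: (unl a) (unr a) h sx => {}a n h sx.
  have [acc [a0 an aS]] := computes_rec_seq h.
  wpstep; apply: wp_mono; first exact: (unpair_cmdP sx).
  move=> s1 [h1 h2 k1]; do 5 wpstep.
  apply: wp_mono; first by apply: (IHf _ _ _ _ a0); updlia.
  move=> s2 [h3 k3]; wpstep.
  (* With [i] iterations left, [x.+1] holds the parameter, [x.+3] the index of the next iteration
     and [x.+4] the accumulator. *)
  apply: (wp_While (n := n) (I := fun i s' => [/\ s' x.+2 = i /\ i <= n,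
    s' x.+1 = a, s' x.+3 = n - i, s' x.+4 = acc (n - i) & keep x s s'])).
  + move=> i s' [[l1 lein] l2 l3 l4 l5]; split; first by rewrite l1.
    do 7 wpstep; apply: wp_mono (pair_cmdP _ _) _ => t1 [m1 n1].
    do 5 wpstep; apply: wp_mono (pair_cmdP _ _) _ => t2 [m2 n2].
    set z := n - i.+1.
    have e1 : t1 x.+4.+1 = pr z (acc z) by rewrite m1; congr pr; updsimpl.
    have e2 : t2 x.+4 = pr a (pr z (acc z)).
      rewrite m2; congr pr; last by updsimpl.
      by rewrite -l2; updsimpl; rewrite n1; updlia.
    wpstep; apply: wp_mono.
      by apply: (IHg _ _ _ _ _ e2); apply: aS; lia.
    move=> t3 [m3 n3].
    have e3 y : y < x.+4 -> t3 y = upd s' x.+2 i y.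
      move=> hy; rewrite n3 // n2 //; updsimpl; rewrite n1; last by lia.
      by updsimpl; rewrite l1.
    wpstep; split; rewrite ?/keep.
    * by updsimpl; rewrite e3; updlia.
    * by updsimpl; rewrite e3; updlia.
    * by updsimpl; rewrite e3; updlia.
    * by updsimpl; rewrite m3; congr acc; rewrite /z; lia.
    * by move=> y hy; rewrite -(l5 y hy); updsimpl; rewrite e3; updlia.
  + move=> s' [[l1 _] l2 l3 l4 l5]; split=> //; wpstep.
    split; first by updsimpl; rewrite l4 subn0.
    by move=> y hy; rewrite -(l5 y hy); updsimpl.
  + rewrite subnn h3; split=> //.
    * by rewrite k3; updlia.
    * by rewrite k3; updlia.
    * by rewrite k3; updlia.
    * by move=> y hy; rewrite -(k1 y hy) k3; updlia.
- inversion h as [| | | | | | | |f' a' n' k hf0 hfS e1 e2 e3]; subst;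
  rename b into n.
  have evalP i b t (Q : store -> Prop) : computes f (pr (s x) i) b ->
      t x = s x -> t x.+1 = i ->
      (forall t', t' x.+2 = b -> keep x.+2 t t' -> Q t') ->
      wp (Seq (Copy x.+3 x) (Seq (Copy x.+4 x.+1)
         (Seq (pair_cmd x.+2) (compile f x.+2)))) Q t.
    move=> hf t0 t1 hQ; do 5 wpstep; apply: wp_mono (pair_cmdP _ _) _.
    move=> s1 [h1 k1]; apply: wp_mono.
      by apply: (IHf _ _ _ _ hf); rewrite h1 -t0 -t1; congr pr; updsimpl.
    by move=> s2 [h2 k2]; apply: hQ => // y hy; rewrite k2 // k1 //; updsimpl.
  (* The values of [f] up to [n]: successors below [n], where the loop goes on, and 0 at [n], where
     it stops. *)
  pose kk i := if i < n then (k i).+1 else 0.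
  have hk i : i <= n -> computes f (pr (s x) i) (kk i).
    by rewrite leq_eqVlt /kk => /orP[/eqP ->|lt]; rewrite ?ltnn ?lt //;
      exact: hfS.
  do 3 wpstep; apply: (evalP _ _ _ _ (hk 0 isT)) => [||s1 h1 k1]; try updlia.
  wpstep; apply: (wp_While (n := n) (I := fun i s' => [/\ s' x.+1 = n - i,
    s' x.+2 = kk (n - i), i <= n & keep x.+1 s s'])).
  + move=> i t [l1 l2 l3 l4]; rewrite l2 /kk; split; first by case: ifP; lia.
    do 2 wpstep; apply: (evalP (n - i)); first by apply: hk; lia.
    * by updsimpl; rewrite l4.
    * by updlia.
    * move=> t' m1 m2; split=> //; first by rewrite m2 //; updlia.
      - by lia.
      - by move=> y hy; rewrite -(l4 y hy) m2; updlia.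
  + move=> t [l1 l2 l3 l4]; split; first by rewrite l2 /kk subn0 ltnn.
    wpstep; split; first by updsimpl; rewrite l1 subn0.
    by move=> y hy; updsimpl; rewrite l4 //; lia.
  + rewrite subnn h1; split=> //; first by rewrite k1 //; updsimpl.
    by move=> y hy; rewrite k1; updlia.
Qed.

(** * Total functions computed by terms of [prec], and their closure properties *)

Definition representable (F : nat -> nat) : Prop :=
  exists p, forall a, computes p a (F a).

Lemma repr_ext F G : F =1 G -> representable F -> representable G.
Proof. by move=> e [p h]; exists p => a; rewrite -e. Qed.

Lemma repr_comp F G :
  representable F -> representable G -> representable (fun a => F (G a)).
Proof. by move=> [p hp] [q hq]; exists (RComp p q) => a; apply: CComp. Qed.

Lemma repr_pr F G :
  representable F -> representable G -> representable (fun a => pr (F a) (G a)).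
Proof. by move=> [p hp] [q hq]; exists (RPair p q) => a; apply: CPair. Qed.

Lemma repr_S F : representable F -> representable (fun a => (F a).+1).
Proof. by apply: repr_comp; exists RSucc => a; apply: CSucc. Qed.

Lemma computes_unl a : computes RFst a (unl a).
Proof. by rewrite [in X in computes _ X](pr_un a); apply: CFst. Qed.

Lemma computes_unr a : computes RSnd a (unr a).
Proof. by rewrite [in X in computes _ X](pr_un a); apply: CSnd. Qed.

Lemma repr_unl F : representable F -> representable (fun a => unl (F a)).
Proof. by apply: repr_comp; exists RFst; apply: computes_unl. Qed.

Lemma repr_unr F : representable F -> representable (fun a => unr (F a)).
Proof. by apply: repr_comp; exists RSnd; apply: computes_unr. Qed.

Lemma repr_id : representable id.
Proof.
exists (RPair RFst RSnd) => a; rewrite [in X in computes _ _ X](pr_un a).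
by apply: CPair; [apply: computes_unl | apply: computes_unr].
Qed.

Lemma repr_const n : representable (fun=> n).
Proof.
by elim: n => [|n /repr_S //]; exists RZero => a; apply: CZero.
Qed.

Lemma repr_rec F G H N :
  representable F -> representable G -> representable N ->
  (forall a, H a 0 = F a) ->
  (forall a n, H a n.+1 = G (pr a (pr n (H a n)))) ->
  representable (fun a => H a (N a)).
Proof.
move=> [p hp] [q hq] hN H0 HS.
apply: repr_ext
  (repr_comp (F := fun z => H (unl z) (unr z)) _ (repr_pr repr_id hN)).
  by move=> a; rewrite unlK unrK.
exists (RRec p q) => z; rewrite {1}(pr_un z); elim: (unr z) => [|n IH].
  by rewrite H0; apply: CRec0.
by rewrite HS; apply: CRecS IH _.
Qed.

(** * Transducers that run while programs *)

(* The states [0] and [1] are the target and a dead state. The gadget number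
   [i] owns two states: in [ent i] the head goes back to the left end, in
   [scan i] it tests the letters from the first one on. *)
Definition ent (i : nat) : nat := i.*2.+2.
Definition scan (i : nat) : nat := i.*2.+3.

Fixpoint size_cmd (c : cmd) : nat :=
  match c with
  | Seq c1 c2 => size_cmd c1 + size_cmd c2
  | If _ c1 c2 => (size_cmd c1 + size_cmd c2).+1
  | While _ c1 => (size_cmd c1).+1
  | _ => 1
  end.

Fixpoint regs (c : cmd) : nat :=
  match c with
  | Inc r | Dec r | Zero r => r
  | Copy r r' => maxn r r'
  | Seq c1 c2 => maxn (regs c1) (regs c2)
  | If r c1 c2 => maxn r (maxn (regs c1) (regs c2))
  | While r c1 => maxn r (regs c1)
  end.

Section Machine.
Variable k : nat.

(** [cur] is the data value under the head, [tmp] is a scratch variable, and [var r] holds register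
    [r], for [r] at most [k]. *)
Definition cur : 'I_k.+3 := ord0.
Definition tmp : 'I_k.+3 := inord 1.
Definition var (r : nat) : 'I_k.+3 := inord r.+2.

Definition noset : {ffun 'I_k.+3 -> 'I_k.+3} := [ffun z => z].
Definition set1v (u v : 'I_k.+3) : {ffun 'I_k.+3 -> 'I_k.+3} :=
  [ffun z => if z == u then v else z].
Definition setall : {ffun 'I_k.+3 -> 'I_k.+3} := [ffun=> cur].

(** States are plain numbers here, so that a large part of the transition list does not depend on
    [n], although the type of states of the machine does. *)
Record raw := Raw {
  r_src : nat;
  r_tag : Defs.tag unit;
  r_test : fml 'I_k.+3;
  r_dst : nat;
  r_dvar : {ffun 'I_k.+3 -> 'I_k.+3};
  r_move : move }.

Record branch := Branch {
  b_dvar : {ffun 'I_k.+3 -> 'I_k.+3};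
  b_dst : nat;
  b_move : move }.

(** [g_init] is applied on leaving the left end, a branch is chosen at each letter scanned, and
    [g_end] is entered if the scan reaches the right end. *)
Record gadget := Gadget {
  g_init : {ffun 'I_k.+3 -> 'I_k.+3};
  g_test : fml 'I_k.+3;
  g_yes : branch;
  g_no : branch;
  g_end : nat }.

Definition halt : branch := Branch noset 1 MStay.

(** [e] numbers the first gadget and [x] is the exit state. [Inc] looks for the first letter above
    the register. [Dec] lets [tmp] trail one letter behind the scan until the scan meets the
    register; [tmp] starts as the register itself, so that 0 stays 0. [If] and [While] compare the
    register with the first letter, which stands for 0. *)
Fixpoint gadgets (c : cmd) (e x : nat) : seq gadget :=
  match c with
  | Inc r => [:: Gadget noset (FLtCurr (var r))
      (Branch (set1v (var r) cur) x MStay) (Branch noset (scan e) MRight) 1]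
  | Dec r => [:: Gadget (set1v tmp (var r)) (FGtCurr (var r))
      (Branch (set1v tmp cur) (scan e) MRight)
      (Branch (set1v (var r) tmp) x MStay) 1]
  | Zero r => [:: Gadget noset FTrue
      (Branch (set1v (var r) cur) x MStay) halt 1]
  | Copy r r' => [:: Gadget (set1v (var r) (var r')) FTrue
      (Branch noset x MStay) halt 1]
  | Seq c1 c2 =>
      gadgets c1 e (ent (e + size_cmd c1)) ++ gadgets c2 (e + size_cmd c1) x
  | If r c1 c2 =>
      Gadget noset (FGtCurr (var r)) (Branch noset (ent e.+1) MStay)
        (Branch noset (ent (e.+1 + size_cmd c1)) MStay) 1 ::
      gadgets c1 e.+1 x ++ gadgets c2 (e.+1 + size_cmd c1) x
  | While r c1 =>
      Gadget noset (FGtCurr (var r)) (Branch noset (ent e.+1) MStay)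
        (Branch noset x MStay) 1 :: gadgets c1 e.+1 (ent e)
  end.

(* The two check gadgets test that the data values of the input are strictly
   increasing, and initialise all registers but [0]. *)
Definition check0 : gadget :=
  Gadget noset FTrue
    (Branch [ffun v => if v == var 0 then v else cur] (scan 1) MRight) halt 1.
Definition check1 : gadget :=
  Gadget noset (FLtCurr tmp) (Branch (set1v tmp cur) (scan 1) MRight) halt
    (ent 2).
Definition verdict : gadget :=
  Gadget noset (FGtCurr (var 0)) halt (Branch noset 0 MStay) 1.

Definition prog (c : cmd) : seq gadget :=
  [:: check0, check1 & rcons (gadgets c 2 (ent (2 + size_cmd c))) verdict].

Definition raws_gadget (i : nat) (g : gadget) : seq raw :=
  [:: Raw (ent i) (Sym tt) FTrue (ent i) noset MLeft;
      Raw (ent i) REnd FTrue (ent i) noset MLeft;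
      Raw (ent i) LEnd FTrue (scan i) (g_init g) MRight;
      Raw (scan i) (Sym tt) (g_test g)
        (b_dst (g_yes g)) (b_dvar (g_yes g)) (b_move (g_yes g));
      Raw (scan i) (Sym tt) (FNot (g_test g))
        (b_dst (g_no g)) (b_dvar (g_no g)) (b_move (g_no g));
      Raw (scan i) REnd FTrue (g_end g) noset MStay].

Fixpoint raws_gadgets (i : nat) (p : seq gadget) : seq raw :=
  if p is g :: p' then raws_gadget i g ++ raws_gadgets i.+1 p' else [::].

Definition base (c : cmd) : nat := ent (size (prog c)).

(* Counting down from [n] to [0] while moving right, these transitions make the
   data variables point to the letter number [n] of the input (from 0), which
   loads [n] into register [0]. *)
Definition raw_chain (c : cmd) (i : nat) : raw :=
  Raw (base c + i) (Sym tt) FTrue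
    (if i is j.+1 then base c + j else ent 0) setall MRight.

(** The tail common to the transition lists for all [n]; everything that varies with [n] is put in
    front of it. *)
Definition raws0 (c : cmd) : seq raw :=
  raw_chain c 0 :: raws_gadgets 0 (prog c).

Fixpoint raws_chain (c : cmd) (n : nat) : seq raw :=
  if n is n'.+1 then raw_chain c n :: raws_chain c n' else raws0 c.

Definition raws (c : cmd) (n : nat) : seq raw :=
  Raw (base c + n).+1 LEnd FTrue (base c + n) setall MRight :: raws_chain c n.

Definition trans_of (m : nat) (r : raw) :
    trans unit void 'I_m.+1 'I_k.+3 void :=
  Trans (inord (r_src r)) (r_tag r) (r_test r) (inord (r_dst r)) (r_dvar r)
    [ffun=> [::]] (r_move r).

Definition machine (c : cmd) (n : nat) :
    pre2dst unit void 'I_(base c + n).+2 'I_k.+3 void :=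
  Pre2DST (inord (base c + n).+1) cur finset.set0 [ffun=> None]
    (map (trans_of (base c + n).+1) (raws c n)).

(** * Shape and determinism of the transition list *)

Lemma size_gadgets c e x : size (gadgets c e x) = size_cmd c.
Proof.
elim: c e x => //= [c1 IH1 c2 IH2|_ c1 IH1 c2 IH2|_ c1 IH1] e x.
- by rewrite size_cat IH1 IH2.
- by rewrite size_cat IH1 IH2.
- by rewrite IH1.
Qed.

Lemma size_prog c : size (prog c) = (size_cmd c).+3.
Proof. by rewrite /= size_rcons size_gadgets. Qed.

Lemma In_cat T (x : T) s1 s2 :
  List.In x (s1 ++ s2)%SEQ <-> List.In x s1 \/ List.In x s2.
Proof. by elim: s1 => [|y s1 IH] /=; [|move: IH]; tauto. Qed.

Lemma In_raws_gadgets r i p : List.In r (raws_gadgets i p) <->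
  exists p1 g p2, p = p1 ++ g :: p2 /\ List.In r (raws_gadget (i + size p1) g).
Proof.
elim: p i => [|g p IH] i.
  by split=> // -[p1 [g [p2 [/(congr1 size)]]]]; rewrite size_cat addnS.
have -> : raws_gadgets i (g :: p) =
  raws_gadget i g ++ raws_gadgets i.+1 p by [].
rewrite In_cat IH.
split=> [[h|[p1 [g' [p2 [-> h]]]]]|].
- by exists [::], g, p; rewrite addn0.
- by exists (g :: p1), g', p2; rewrite /= -addSnnS.
- move=> [[|g1 p1] [g' [p2 [[-> e] h]]]].
    by left; rewrite addn0 in h.
  by right; exists p1, g', p2; rewrite addSnnS.
Qed.

Lemma In_raws_chain r c n : List.In r (raws_chain c n) <->
  (exists2 i, i <= n & r = raw_chain c i) \/
  List.In r (raws_gadgets 0 (prog c)).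
Proof.
elim: n => [|n IH].
  split=> [[<-|h]|[[i]|h]]; [by left; exists 0|by right| |by right].
  by rewrite leqn0 => /eqP -> ->; left.
have -> : List.In r (raws_chain c n.+1) <->
    raw_chain c n.+1 = r \/ List.In r (raws_chain c n) by [].
rewrite IH; split=> [[<-|[[i h ->]|h]]|[[i h ->]|h]].
- by left; exists n.+1.
- by left; exists i => //; lia.
- by right.
- move: h; rewrite leq_eqVlt => /orP[/eqP->|h]; first by left.
  by right; left; exists i.
- by right; right.
Qed.

Variant raws_spec c n (r : raw) : Prop :=
| RawsInit of r = Raw (base c + n).+1 LEnd FTrue (base c + n) setall MRight
| RawsChain i of i <= n & r = raw_chain c i
| RawsGadget p1 g p2 of prog c = p1 ++ g :: p2
    & List.In r (raws_gadget (size p1) g).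

Lemma rawsP r c n : List.In r (raws c n) <-> raws_spec c n r.
Proof.
split=> [[<-|/In_raws_chain [[i h e]|]]|[->|i h ->|p1 g p2 e h]].
- exact: RawsInit.
- exact: RawsChain h e.
- by case/In_raws_gadgets=> p1 [g [p2 [e h]]]; apply: RawsGadget e h.
- by left.
- by right; apply/In_raws_chain; left; exists i.
- right; apply/In_raws_chain; right; apply/In_raws_gadgets.
  by exists p1, g, p2.
Qed.

Lemma raws_gadget_src r i g : List.In r (raws_gadget i g) ->
  r_src r = ent i \/ r_src r = scan i.
Proof. by move=> /= [<-|[<-|[<-|[<-|[<-|[<-|//]]]]]] /=; auto. Qed.

Lemma raws_src r c n : List.In r (raws c n) ->
  1 < r_src r <= (base c + n).+1.
Proof.
case/rawsP=> [->|i h ->|p1 g p2 e /raws_gadget_src].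
- by rewrite /= /base /ent; lia.
- by rewrite /= /base /ent; lia.
- have : size p1 < size (prog c) by rewrite e size_cat /=; lia.
  by rewrite /base /ent /scan; lia.
Qed.

Definition exclusive (phi psi : fml 'I_k.+3) : Prop :=
  psi = FNot phi \/ phi = FNot psi.

(** The source state separates the three kinds of transitions and determines the chain index or the
    gadget. Inside a gadget, only the two branches of a scan share source and tag, and one test is
    the negation of the other. *)
Lemma raws_deterministic r r' c n :
  List.In r (raws c n) -> List.In r' (raws c n) ->
  r_src r = r_src r' -> r_tag r = r_tag r' ->
  r = r' \/ exclusive (r_test r) (r_test r').
Proof.
have lt p1 g p2 : prog c = p1 ++ g :: p2 -> (size p1) < size (prog c).
  by move=> ->; rewrite size_cat /=; lia.
case/rawsP=> [->|i h ->|p1 g p2 e h];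
  case/rawsP=> [->|i' h' ->|p1' g' p2' e' h'] //=.
- by left.
- by move: (lt _ _ _ e') (raws_gadget_src h'); rewrite /base /ent /scan; lia.
- move=> e _; have -> : i = i' by lia. by left.
- by move: (lt _ _ _ e') (raws_gadget_src h'); rewrite /base /ent /scan; lia.
- by move: (lt _ _ _ e) (raws_gadget_src h); rewrite /base /ent /scan; lia.
- by move: (lt _ _ _ e) (raws_gadget_src h); rewrite /base /ent /scan; lia.
- move=> es; have ez : size p1 = size p1'.
    move: (raws_gadget_src h) (raws_gadget_src h') es; rewrite /ent /scan; lia.
  have eg : g = g'.
    have {}e : p1' ++ g' :: p2' = p1 ++ g :: p2 by rewrite -e -e'.
    have := congr1 (drop (size p1)) e.
    by rewrite !drop_size_cat // => -[].
  subst g'; rewrite -ez in h' => {ez e e'}.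
  move: h h' es; rewrite /= /exclusive.
  by move=> [<-|[<-|[<-|[<-|[<-|[<-|//]]]]]]
    [<-|[<-|[<-|[<-|[<-|[<-|//]]]]]] //=; rewrite ?/ent ?/scan; auto; lia.
Qed.

End Machine.

Lemma In_map T U (f : T -> U) y s :
  List.In y (map f s) <-> exists2 x, List.In x s & y = f x.
Proof.
elim: s => [|x s IH] /=; first by split=> // -[].
rewrite IH; split=> [[<-|[z h ->]]|[z [->|h] ->]]; try by left.
- by exists x => //; left.
- by exists z => //; right.
- by right; exists z.
Qed.

Lemma machine_valid d (D : orderType d) k c n : is_2dst D (machine k c n).
Proof.
split=> [q s x|t x|t t' ht ht' ne es et]; [by case: x|by case: x|].
have [r rin er] := proj1 (In_map _ _ _) ht.
have [r' rin' er'] := proj1 (In_map _ _ _) ht'.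
subst t t'.
have {}es : r_src r = r_src r'.
  move/(congr1 val): es; move: (raws_src rin) (raws_src rin') => h h'.
  by rewrite /= !inordK //; lia.
have [e|ex] := raws_deterministic rin rin' es et; first by case: ne; rewrite e.
by move=> b /=; case: ex => -> /=; case: (fml_eval _ _ _) => // -[].
Qed.

Lemma step_deterministic d (D : orderType d) (Sig Gam Q V X : finType)
    (S : pre2dst Sig Gam Q V X) (w : seq (Sig * D)) C C1 C2 :
  is_2dst D S -> step S w C C1 -> step S w C C2 -> C1 = C2.
Proof.
case=> _ _ det h1; case: h1 => t i j x b tin _ ti te tm h2.
inversion h2 as [t' i' j' x' b' tin' _ ti' te' tm' e1 e2]; subst.
have [ett xx] : t_tag t' = t_tag t /\ x' = x by move: ti'; rewrite ti => -[].
subst x'; have [ett'|ne] := pselect (t' = t).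
  by subst t'; move: tm'; rewrite tm => -[->].
case: (det _ _ tin' tin ne e1 ett (dval (read S x b))).
by rewrite /= te te'.
Qed.

(** * Backward simulation of a while program on a fixed input *)

Section Simulation.
Variables (d : Order.disp_t) (D : orderType d) (k : nat) (c0 : cmd) (n : nat).
Variables (w : seq (unit * D)) (x0 : D).
Let m := (base k c0 + n).+1.
Let S := machine k c0 n.
Let L := size w.
Let dat (i : nat) : D := nth x0 (map snd w) i.

Definition conf (a pos : nat) (b : valuation D void 'I_k.+3 void) :=
  Config (inord a : 'I_m.+1) pos b.

(* The simulation is backward in [P]. It is used with [P] = the target is
   reachable, and with [P] = the target is not reachable, where determinism
   gives [P_step] and stuck configurations (the input is too short or not
   sorted) satisfy [P]. *)
Variable P : config D void 'I_m.+1 'I_k.+3 void -> Prop.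
Hypothesis P_step : forall C C', step S w C C' -> P C' -> P C.

Definition P_stuck : Prop :=
  forall C, (forall C', ~ step S w C C') -> c_state C <> inord 0 -> P C.

Definition dread (x : option D) (b : valuation D void 'I_k.+3 void) z :=
  if z == cur k then x else dval b z.

Lemma tape_sym i : i < L -> onth (tape w) i.+1 = Some (Sym tt, Some (dat i)).
Proof.
move=> h; rewrite /= -cats1 onth_cat size_map h onth_map /dat.
rewrite (nth_map (tt, x0)) //.
have: onth w i by rewrite onthTE.
by case e: (onth w i) => [[[] y]|//] _; rewrite (onth_nth _ _ _ _ e).
Qed.

Lemma tape_end : onth (tape w) L.+1 = Some (REnd, None).
Proof. by rewrite /= -cats1 onth_cat size_map ltnn subnn. Qed.

Lemma P_raw r pos x b j :
  List.In r (raws k c0 n) -> onth (tape w) pos = Some (r_tag r, x) ->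
  fml_eval (cur k) (dval (read S x b)) (r_test r) = Some true ->
  move_head (r_tag r) (r_move r) pos = Some j ->
  (forall b', (forall z, dval b' z = dread x b (r_dvar r z)) ->
    P (conf (r_dst r) j b')) ->
  P (conf (r_src r) pos b).
Proof.
move=> rin rt re rm hP; pose t := trans_of m r.
have tin : List.In t (delta S) by apply/In_map; exists r.
have := @Step _ D _ _ _ _ _ S w t pos j x b tin _ rt re rm.
rewrite finset.in_set0 => /(_ isT) /P_step; apply.
by apply: hP => z; rewrite !ffunE.
Qed.

(** All sources are at least 2, so nothing leaves state 1, and 1 is not the target. *)
Lemma dead_stuck pos b : P_stuck -> P (conf 1 pos b).
Proof.
apply=> [C' h|/(congr1 val)]; last by rewrite /= !inordK.
move E: (conf 1 pos b) h => C h.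
case: h E => t i j x b' tin _ _ _ _ [e _ _].
have [r /raws_src rs et] := proj1 (In_map _ _ _) tin; move: e; rewrite et.
by move/(congr1 val); rewrite /= !inordK //; lia.
Qed.

Definition in_prog (e : nat) (l : seq (gadget k)) : Prop :=
  exists p1 p2, prog k c0 = p1 ++ l ++ p2 /\ size p1 = e.

Lemma in_prog_cat e l1 l2 :
  in_prog e (l1 ++ l2) -> in_prog e l1 /\ in_prog (e + size l1) l2.
Proof.
move=> [p1 [p2 [h s]]]; split; first by exists p1, (l2 ++ p2); rewrite h !catA.
by exists (p1 ++ l1), p2; rewrite h !catA size_cat s.
Qed.

Lemma in_prog_cons e g l :
  in_prog e (g :: l) -> in_prog e [:: g] /\ in_prog e.+1 l.
Proof. by move/(@in_prog_cat _ [:: g]); rewrite addn1. Qed.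

Lemma in_prog_raw e g r : in_prog e [:: g] -> List.In r (raws_gadget e g) ->
  List.In r (raws k c0 n).
Proof. by move=> [p1 [p2 [h <-]]] hr; apply/rawsP; apply: RawsGadget h hr. Qed.

(** Induction on the head position. Each step overwrites [cur], which is undefined at the left end,
    so only values not taken from [cur] are tracked. *)
Lemma P_rewind e g pos b : in_prog e [:: g] -> pos <= L.+1 ->
  (forall b', (forall z, z != cur k -> g_init g z != cur k ->
     dval b' z = dval b (g_init g z)) -> P (conf (scan e) 1 b')) ->
  P (conf (ent e) pos b).
Proof.
move=> hg; elim: pos b => [|pos IH] b hpos hP.
  apply: (P_raw (r := Raw (ent e) LEnd FTrue (scan e) (g_init g) MRight)
                (x := None) (j := 1)) => //.
    by apply: (in_prog_raw hg); do 2 right; left.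
  by move=> b' hb'; apply: hP => z _ zc; rewrite hb' /dread (negbTE zc).
have hP' x b' : (forall z, dval b' z = dread x b (noset k z)) ->
    P (conf (ent e) pos b').
  move=> hb'; apply: IH; first by lia.
  move=> b'' hb''; apply: hP => z zc gc.
  by rewrite hb'' // hb' /dread !ffunE (negbTE gc).
move: hpos; rewrite leq_eqVlt => /orP[/eqP[epos]|hpos].
  apply: (P_raw (r := Raw (ent e) REnd FTrue (ent e) (noset k) MLeft)
                (x := None) (j := pos)) => //=; last by move=> b'; apply: hP'.
  - by apply: (in_prog_raw hg); right; left.
  - by rewrite epos; apply: tape_end.
apply: (P_raw (r := Raw (ent e) (Sym tt) FTrue (ent e) (noset k) MLeft)
              (x := Some (dat pos)) (j := pos)) => //=.
- by apply: (in_prog_raw hg); left.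
- by apply: tape_sym; lia.
- by move=> b'; apply: hP'.
Qed.

Lemma P_scan e g i b j y : in_prog e [:: g] -> i < L ->
  fml_eval (cur k) (dval (read S (Some (dat i)) b)) (g_test g) = Some y ->
  let br := if y then g_yes g else g_no g in
  move_head (@Sym unit tt) (b_move br) i.+1 = Some j ->
  (forall b', (forall z, dval b' z = dread (Some (dat i)) b (b_dvar br z)) ->
    P (conf (b_dst br) j b')) ->
  P (conf (scan e) i.+1 b).
Proof.
move=> hg hi ht br hm; have tp := tape_sym hi.
pose r := Raw (scan e) (Sym tt) (if y then g_test g else FNot (g_test g))
  (b_dst br) (b_dvar br) (b_move br).
apply: (P_raw (r := r) (x := Some (dat i)) (j := j)) => //.
- apply: (in_prog_raw hg); rewrite /r /br; case: (y) => /=; tauto.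
- by move: ht; rewrite /r; case: (y) => //= ->.
Qed.

Lemma P_scan_end e g b : in_prog e [:: g] ->
  (forall b', (forall z, z != cur k -> dval b' z = dval b z) ->
    P (conf (g_end g) L.+1 b')) ->
  P (conf (scan e) L.+1 b).
Proof.
move=> hg hP.
apply: (P_raw (r := Raw (scan e) REnd FTrue (g_end g) (noset k) MStay)
              (x := None) (j := L.+1)) => //.
- by apply: (in_prog_raw hg); do 5 right; left.
- exact: tape_end.
- by move=> b' hb'; apply: hP => z zc; rewrite hb' /dread ffunE (negbTE zc).
Qed.

Lemma eval_lt (x y : D) (b : valuation D void 'I_k.+3 void) v :
  v != cur k -> dval b v = Some y ->
  fml_eval (cur k) (dval (read S (Some x) b)) (FLtCurr v) = Some (y < x)%O.
Proof. by move=> vc e; rewrite /= !ffunE eqxx (negbTE vc) e. Qed.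

Lemma eval_gt (x y : D) (b : valuation D void 'I_k.+3 void) v :
  v != cur k -> dval b v = Some y ->
  fml_eval (cur k) (dval (read S (Some x) b)) (FGtCurr v) = Some (x < y)%O.
Proof. by move=> vc e; rewrite /= !ffunE eqxx (negbTE vc) e. Qed.

Lemma val_var r : r <= k -> val (var k r) = r.+2.
Proof. by move=> h; rewrite /= inordK. Qed.

Lemma eq_var r r' : r <= k -> r' <= k -> (var k r == var k r') = (r == r').
Proof. by move=> h h'; rewrite -val_eqE !val_var. Qed.

Lemma var_cur r : r <= k -> (var k r == cur k) = false.
Proof. by move=> h; rewrite -val_eqE val_var. Qed.

Lemma var_tmp r : r <= k -> (var k r == tmp k) = false.
Proof. by move=> h; rewrite -val_eqE val_var //= inordK. Qed.

Lemma tmp_cur : (tmp k == cur k) = false.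
Proof. by rewrite -val_eqE /= inordK. Qed.

(** The number [v] is represented by letter number [v], counted from 0; hence the bound by [L]. *)
Definition holds (s : store) (b : valuation D void 'I_k.+3 void) : Prop :=
  forall r, r <= k -> s r < L /\ dval b (var k r) = Some (dat (s r)).

Lemma holds_upd s b b' r v : holds s b -> r <= k -> v < L ->
  dval b' (var k r) = Some (dat v) ->
  (forall r', r' <= k -> r' != r -> dval b' (var k r') = dval b (var k r')) ->
  holds (upd s r v) b'.
Proof.
move=> hs hr hv e h r' hr'; rewrite /upd; have [->|ne] := eqVneq r' r => //.
by rewrite h //; apply: hs.
Qed.

Lemma holds_eq s b b' : holds s b ->
  (forall r, r <= k -> dval b' (var k r) = dval b (var k r)) -> holds s b'.
Proof. by move=> hs h r hr; rewrite h //; apply: hs. Qed.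

(** The head may be anywhere on the tape, and [cur] and [tmp] are arbitrary: each gadget rewinds
    first, so it can follow any other. *)
Definition Pstore (a : nat) (s : store) : Prop :=
  forall pos b, pos <= L.+1 -> holds s b -> P (conf a pos b).

Definition start : store := upd (fun=> 0) 0 n.

Lemma P_check pos b : n < L -> pos <= L.+1 -> dval b (var k 0) = Some (dat n) ->
  (sorted <%O (map snd w) \/ P_stuck) ->
  (sorted <%O (map snd w) -> Pstore (ent 2) start) ->
  P (conf (ent 0) pos b).
Proof.
move=> nL hpos e0 hw hP.
have L0 : 0 < L by lia.
have hg0 : in_prog 0 [:: check0 k] by exists [::], (behead (prog k c0)).
have hg1 : in_prog 1 [:: check1 k].
  by exists [:: check0 k], (behead (behead (prog k c0))).
apply: (P_rewind hg0) => // b1; rewrite /= => hb1.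
apply: (P_scan (j := 2) (y := true) hg0) => // b2 /= hb2.
have t2 : dval b2 (tmp k) = Some (dat 0).
  by rewrite hb2 /dread ffunE [tmp k == _]eq_sym var_tmp // eqxx.
have {}hb2 : holds start b2.
  move=> r hr; rewrite /start /upd hb2 /dread ffunE eq_var //.
  case: eqP => [->|_]; last by rewrite eqxx.
  by rewrite var_cur // hb1 ?ffunE ?var_cur.
(* The first [j] letters are known to increase, [tmp] holds the last of them, and the head is on the
   next tape cell, at position [j.+1]. *)
suff loop t : forall j b, L - j = t -> 0 < j <= L ->
    (forall i, i.+1 < j -> (dat i < dat i.+1)%O) ->
    dval b (tmp k) = Some (dat j.-1) -> holds start b ->
    P (conf (scan 1) j.+1 b).
  by apply: (loop _ 1 b2 erefl).
elim: t => [|t IH] j {}b2 ej hj hs {}t2 {}hb2.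
  have {}ej : j = L by lia.
  rewrite ej in hs *; apply: (P_scan_end hg1) => b3 hb3; apply: hP => //.
    by apply/(sortedP x0); rewrite size_map.
  by apply: (holds_eq hb2) => r hr; rewrite hb3 ?var_cur.
have jL : j < L by lia.
case ey : (dat j.-1 < dat j)%O; last first.
  apply: (P_scan (j := j.+1) (y := false) hg1 jL) => // [|b3 _].
    by rewrite (eval_lt _ _ t2) ?tmp_cur ?ey.
  case: hw => [/(sortedP x0)|]; last exact: dead_stuck.
  by move=> /(_ j.-1); rewrite prednK ?size_map;
    [move=> /(_ jL); rewrite ey|lia].
apply: (P_scan (j := j.+2) (y := true) hg1 jL) => // [|b3 hb3].
  by rewrite (eval_lt _ _ t2) ?tmp_cur ?ey.
apply: IH; try lia.
- move=> i; rewrite ltnS leq_eqVlt => /orP[/eqP ei|]; last exact: hs.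
  by move: ey; rewrite -ei.
- by rewrite hb3 /dread !ffunE !eqxx.
- by apply: (holds_eq hb2) => r hr; rewrite hb3 /dread ffunE var_tmp // var_cur.
Qed.

(** A chain state has transitions on letters only, so it is stuck at the right end when the input is
    too short. *)
Lemma chain_stuck i b : i <= n -> P_stuck -> P (conf (base k c0 + i) L.+1 b).
Proof.
move=> hi; apply=> [C'|/(congr1 val)]; last by rewrite /= !inordK //; lia.
move E: (conf _ _ b) => C h.
case: h E => t q j x b' tin _ tp _ _ [e eq _]; rewrite -eq tape_end in tp.
have [r rin et] := proj1 (In_map _ _ _) tin; rewrite et /= in e tp.
have rs := raws_src rin.
have {e}: base k c0 + i = r_src r.
  have h1 : base k c0 + i < m.+1 by rewrite /m; lia.
  have h2 : r_src r < m.+1 by rewrite /m; lia.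
  by rewrite -(inordK h1) e inordK.
move: tp {rs}.
case/rawsP: rin => [->|i' _ ->|p1 g p2 e /raws_gadget_src h _] //.
have : size p1 < size (prog k c0) by rewrite e size_cat /=; lia.
by move: h; rewrite /base /ent /scan; lia.
Qed.

Lemma P_init : (n < L \/ P_stuck) ->
  (n < L -> forall b, dval b (var k 0) = Some (dat n) ->
     P (conf (ent 0) n.+2 b)) ->
  P (init_config D S).
Proof.
move=> hL hP.
pose r0 := Raw (base k c0 + n).+1 LEnd FTrue (base k c0 + n) (setall k) MRight.
apply: (P_raw (r := r0) (x := None) (j := 1)) => //; first by left.
move=> b _ /=.
(* [p] letters have been passed and [i] more precede the one to load; at [i = 0] the head is on
   letter [p = n]. *)
suff loop i : forall p b, p + i = n -> p <= L ->
    P (conf (base k c0 + i) p.+1 b).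
  exact: loop.
elim: i => [|i IH] p {}b hn; rewrite leq_eqVlt => /orP[/eqP ep|pL].
- by rewrite ep; apply: chain_stuck => //; case: hL => //; lia.
- apply: (P_raw (r := raw_chain k c0 0) (x := Some (dat p)) (j := p.+2)) => //.
  + by apply/rawsP; apply: (@RawsChain _ _ _ _ 0).
  + exact: tape_sym.
  + move=> b' hb'; rewrite (_ : p = n); last by lia.
    by apply: hP; [lia|rewrite hb' /dread ffunE eqxx (_ : p = n) //; lia].
- by rewrite ep; apply: chain_stuck; [lia|case: hL => //; lia].
- apply: (P_raw (r := raw_chain k c0 i.+1) (x := Some (dat p)) (j := p.+2))
    => //.
  + by apply/rawsP; apply: (@RawsChain _ _ _ _ i.+1) => //; lia.
  + exact: tape_sym.
  + by move=> b' _; apply: IH => //; lia.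
Qed.

Section Sorted.
Hypothesis w_sorted : sorted <%O (map snd w).

(** Turns the tests of the transducer on a sorted input into comparisons of numbers. *)
Lemma dat_lt i j : i < L -> j < L -> (dat i < dat j)%O = (i < j).
Proof.
move=> hi hj; rewrite /dat.
by rewrite Order.POrderTheory.lt_sorted_ltn_nth // inE size_map.
Qed.

Lemma sim_Zero e x r s : r <= k -> in_prog e (gadgets k (Zero r) e x) ->
  Pstore x (upd s r 0) -> Pstore (ent e) s.
Proof.
move=> hr hg hx pos b hpos hs; apply: (P_rewind hg) => // b1 hb1.
have L0 : 0 < L by have [] := hs _ hr; lia.
apply: (P_scan (j := 1) (y := true) hg) => // b2 hb2; apply: hx => //.
apply: (holds_upd hs) => // [|r' hr' ne]; rewrite hb2 /dread !ffunE ?eqxx //.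
rewrite eq_var // (negbTE ne) var_cur // hb1 ?ffunE ?var_cur //.
Qed.

Lemma sim_Copy e x r r' s : r <= k -> r' <= k ->
  in_prog e (gadgets k (Copy r r') e x) ->
  Pstore x (upd s r (s r')) -> Pstore (ent e) s.
Proof.
move=> hr hr' hg hx pos b hpos hs; apply: (P_rewind hg) => // b1 hb1.
have [lt er] := hs _ hr'; have L0 : 0 < L by lia.
apply: (P_scan (j := 1) (y := true) hg) => // b2 hb2; apply: hx => //.
apply: (holds_upd hs) => // [|q hq ne];
  rewrite hb2 /dread !ffunE var_cur // hb1 ?ffunE ?var_cur ?eqxx //.
- by rewrite var_cur.
- by rewrite eq_var // (negbTE ne).
- by rewrite eq_var // (negbTE ne) var_cur.
Qed.

(** Both branches stay put, so only letter 0 is read; the register lies above it iff its value is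
    nonzero. *)
Lemma sim_test e g r s (b1 b2 : branch k) : r <= k ->
  g = Gadget (noset k) (FGtCurr (var k r)) b1 b2 1 -> in_prog e [:: g] ->
  b_dvar b1 = noset k -> b_dvar b2 = noset k -> 
  b_move b1 = MStay -> b_move b2 = MStay ->
  Pstore (b_dst (if s r != 0 then b1 else b2)) s -> Pstore (ent e) s.
Proof.
move=> hr -> hg d1 d2 m1 m2 hx pos b hpos hs; apply: (P_rewind hg) => // b3 hb3.
have [lt er] := hs _ hr; have L0 : 0 < L by lia.
have h3 : dval b3 (var k r) = Some (dat (s r)).
  by rewrite hb3 ?ffunE ?var_cur.
apply: (P_scan (j := 1) hg L0) => /=.
  by apply: (eval_gt _ _ h3); rewrite var_cur.
  by rewrite dat_lt // lt0n; case: ifP; rewrite ?m1 ?m2.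
rewrite dat_lt // lt0n => b4 hb4; apply: hx => //.
apply: (holds_eq hs) => r' hr'; rewrite hb4.
have -> : b_dvar (if s r != 0 then b1 else b2) = noset k by case: ifP.
by rewrite /dread ffunE var_cur // hb3 /= ?ffunE ?var_cur.
Qed.

Lemma sim_Inc e x r s : r <= k -> in_prog e (gadgets k (Inc r) e x) ->
  ((s r).+1 < L \/ P_stuck) ->
  Pstore x (upd s r (s r).+1) -> Pstore (ent e) s.
Proof.
move=> hr hg hL hx pos b hpos hs; apply: (P_rewind hg) => // b1 hb1.
have [lt er] := hs _ hr.
have {hb1} : holds s b1.
  by apply: (holds_eq hs) => r' hr'; rewrite hb1 ?ffunE ?var_cur.
have : 0 <= (s r).+1 by [].
move: {2}((s r).+1 - 0) (erefl ((s r).+1 - 0)) => t.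
elim: t (0) b1 => [|t IH] j b1 ej hj hb1; have [_ e1] := hb1 _ hr.
  have {ej hj} -> : j = (s r).+1 by lia.
  (* If the register points to the last letter, it has no successor: the scan runs into the right
     end and enters the dead state. *)
  move: (lt); rewrite leq_eqVlt => /orP[/eqP eL|lt'].
    rewrite eL; apply: (P_scan_end hg) => b2 _; case: hL; first by lia.
    exact: dead_stuck.
  apply: (P_scan (j := (s r).+2) (y := true) hg lt') => // [|b2 hb2].
    by rewrite (eval_lt _ _ e1) ?var_cur // dat_lt ?ltnSn.
  apply: hx; first by lia.
  apply: (holds_upd hb1) => // [|r' hr' ne]; rewrite hb2 /dread !ffunE ?eqxx //.
  by rewrite eq_var // (negbTE ne) var_cur.
have jL : j < L by lia.
apply: (P_scan (j := j.+2) (y := false) hg jL) => // [|b2 hb2].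
  rewrite (eval_lt _ _ e1) ?var_cur // dat_lt // ltnNge.
  by rewrite (_ : j <= s r) //; lia.
apply: IH; try lia.
by apply: (holds_eq hb1) => r' hr'; rewrite hb2 /dread ffunE var_cur.
Qed.

Lemma sim_Dec e x r s : r <= k -> in_prog e (gadgets k (Dec r) e x) ->
  Pstore x (upd s r (s r).-1) -> Pstore (ent e) s.
Proof.
move=> hr hg hx pos b hpos hs; apply: (P_rewind hg) => // b1 hb1.
have [lt er] := hs _ hr.
have t1 : dval b1 (tmp k) = Some (dat (s r)).
  by rewrite hb1 ?ffunE ?eqxx ?tmp_cur ?var_cur.
have {}hb1 : holds s b1.
  apply: (holds_eq hs) => r' hr'.
  by rewrite hb1 ?ffunE ?eqxx ?var_tmp ?tmp_cur ?var_cur.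
(* The number of the letter in [tmp] when the scan reads letter [j]; at [j = 0] it is still the
   value of the register. *)
pose pre j := if j is j'.+1 then j' else s r.
change (Some (dat (s r))) with (Some (dat (pre 0))) in t1.
have : 0 <= s r by [].
move: {2}(s r - 0) (erefl (s r - 0)) => t.
elim: t (0) b1 t1 hb1 => [|t IH] j b1 t1 hb1 ej hj; have [_ e1] := hb1 _ hr.
  have {}ej : j = s r by lia. subst j.
  apply: (P_scan (j := (s r).+1) (y := false) hg lt) => // [|b2 hb2].
    by rewrite (eval_gt _ _ e1) ?var_cur // dat_lt ?ltnn.
  apply: hx; first by lia.
  apply: (holds_upd hb1) => //; first by lia.
    rewrite hb2 /dread !ffunE eqxx tmp_cur t1; rewrite /pre.
    by case: (s r).
  by move=> r' hr' ne; rewrite hb2 /dread !ffunE eq_var // (negbTE ne) var_cur.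
have jL : j < L by lia.
apply: (P_scan (j := j.+2) (y := true) hg jL) => // [|b2 hb2].
  by rewrite (eval_gt _ _ e1) ?var_cur // dat_lt // (_ : j < s r) //; lia.
apply: IH; try lia.
  by rewrite hb2 /dread !ffunE !eqxx.
by apply: (holds_eq hb1) => r' hr'; rewrite hb2 /dread ffunE var_tmp // var_cur.
Qed.

(** Induction on the execution. Increments reach at most [N], so if [N < L] every value has its
    letter; otherwise the dead state entered by a failing [Inc] satisfies [P]. *)
Lemma sim N c s s' : exec N c s s' -> forall e x, regs c <= k ->
  in_prog e (gadgets k c e x) -> (N < L \/ P_stuck) ->
  Pstore x s' -> Pstore (ent e) s.
Proof.
elim=> {c s s'} [r s lt|r s|r s|r r' s|c1 c2 s s1 s2 _ IH1 _ IH2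
  |r c1 c2 s s' h _ IH|r c1 c2 s s' h _ IH|r c s s1 s2 h _ IH1 _ IH2|r c s h]
  e x hr hg hN hx.
- by apply: sim_Inc hg _ hx => //; case: hN => h; [left; lia|right].
- exact: sim_Dec hg hx.
- exact: sim_Zero hg hx.
- by apply: sim_Copy hg hx => //; move: hr => /=; lia.
- move: hr => /=; rewrite geq_max => /andP[hr1 hr2].
  have [hg1 hg2] := in_prog_cat hg; rewrite size_gadgets in hg2.
  by apply: (IH1 _ _ hr1 hg1) => //; apply: (IH2 _ _ hr2 hg2).
- move: hr => /=; rewrite !geq_max => /and3P[hr hr1 hr2].
  have [hg0 /in_prog_cat [hg1 _]] := in_prog_cons hg.
  by apply: (sim_test hr erefl hg0) => //; rewrite h; apply: (IH _ _ hr1 hg1).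
- move: hr => /=; rewrite !geq_max => /and3P[hr hr1 hr2].
  have [hg0 /in_prog_cat [_ hg2]] := in_prog_cons hg.
  rewrite size_gadgets in hg2.
  by apply: (sim_test hr erefl hg0) => //; rewrite h; apply: (IH _ _ hr2 hg2).
- move: (hr) => /=; rewrite !geq_max => /andP[hr0 hr1].
  have [hg0 hg1] := in_prog_cons hg.
  apply: (sim_test hr0 erefl hg0) => //; rewrite h.
  apply: (IH1 _ _ hr1 hg1) => //.
  exact: (IH2 _ _ hr hg).
- move: (hr) => /=; rewrite !geq_max => /andP[hr0 hr1].
  have [hg0 hg1] := in_prog_cons hg.
  by apply: (sim_test hr0 erefl hg0) => //; rewrite h.
Qed.

End Sorted.

Lemma P_run N s' : exec N c0 start s' -> regs c0 <= k ->
  (sorted <%O (map snd w) /\ maxn N n < L) \/ P_stuck ->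
  (forall pos b, P (conf (if s' 0 != 0 then 1 else 0) pos b)) ->
  P (init_config D S).
Proof.
move=> he hr hw hP; apply: P_init => [|nL b e].
  by case: hw => [[_]|]; [left; lia|right].
apply: (P_check nL) => // [|w_sorted]; first by case: hw => [[]|]; [left|right].
have hg : in_prog 2 (gadgets k c0 2 (ent (2 + size_cmd c0)) ++ [:: verdict k]).
  by exists [:: check0 k; check1 k], [::]; rewrite cats0 cats1.
have [hg1 hg2] := in_prog_cat hg; rewrite size_gadgets in hg2.
apply: (sim w_sorted he hr hg1); first by case: hw => [[_]|]; [left; lia|right].
apply: (sim_test w_sorted (r := 0) _ _ hg2) => //.
by move=> pos b' _ _; case: ifP (hP pos b').
Qed.

End Simulation.

(** * Correctness of the transducer over an infinite data domain *)

Lemma sorted_word d (D : orderType d) (N : nat) :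
  infinite_set [set: D]%classic ->
  exists w : seq (unit * D), sorted <%O (map snd w) /\ size w = N.
Proof.
move=> infD; suff [s us <-] : exists2 s : seq D, uniq s & size s = N.
  exists (map (pair tt) (sort <=%O%O s)).
  rewrite -map_comp map_id size_map size_sort; split=> //.
  by rewrite Order.TotalTheory.sort_lt_sorted.
elim: N => [|N [s us sN]]; first by exists [::].
(* No finite list exhausts the infinite domain, so a new value can always be added. *)
have [xs|all_s] := pselect (exists x, x \notin s).
  by case: xs => x xs; exists (x :: s); rewrite /= ?xs ?us ?sN.
exfalso; apply: infD; apply/finite_seqP; exists s.
apply/seteqP; split=> x //= _.
by apply/negPn/negP => xs; apply: all_s; exists x.
Qed.

(** If the result is 0, a long sorted input witnesses reachability. Otherwise every input has to be
    excluded, including short and unsorted ones. *)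
Lemma machine_correct d (D : orderType d) k c n N s' :
  infinite_set [set: D]%classic -> exec N c (start n) s' -> regs c <= k ->
  (exists w : seq (unit * D), enters (machine k c n) w (inord 0)) <-> s' 0 = 0.
Proof.
move=> infD he hr; pose S := machine k c n.
(* A word of length 1 provides the default value for [nth]. *)
have [w0 [_ s1]] := sorted_word 1 infD.
have x0 : D by case: w0 s1 => [|a _] // _; exact: a.2.
pose reach (w : seq (unit * D)) C :=
  exists2 C', clos_refl_trans _ (step S w) C C' & c_state C' = inord 0.
split=> [[w hw]|e0]; last first.
  have [w [ws wN]] := sorted_word (maxn N n).+1 infD.
  exists w; apply: (@P_run _ D k c n w x0 (reach w) _ N s') => //.
  - move=> C C' st [C1 r1 e1]; exists C1 => //.
    by apply: rt_trans r1; apply: rt_step.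
  - by left; rewrite wN.
  - by move=> pos b; rewrite e0; eexists; first exact: rt_refl.
have [//|ne] := eqVneq (s' 0) 0; exfalso; move: hw; rewrite -/S.
have stuck : P_stuck (c0 := c) (n := n) w (fun C => ~ reach w C).
  move=> C nost ne0 [C' r e].
  have : clos_refl_trans_1n _ (step S w) C C' by apply: clos_rt_rt1n.
  by move=> h; case: h e => // C1 C2 /nost.
apply: (@P_run _ D k c n w x0 (fun C => ~ reach w C) _ N s') => //.
(* The target is the source of no transition, so a path from [C] to it begins with a step, which by
   determinism is the one to [C']. *)
- move=> C C' st nr [C'' r e]; apply: nr.
  have : clos_refl_trans_1n _ (step S w) C C'' by apply: clos_rt_rt1n.
  move=> h; case: h e => [e0|C1 C2 st1 r1 e0].
    case: st e0 => t i j x b tin _ _ _ _ /= et.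
    have [r' rin et'] := proj1 (In_map _ _ _) tin.
    move: et; rewrite et' => /(congr1 val).
    have := raws_src rin; rewrite /= => rs; rewrite !inordK //; lia.
  exists C2 => //; rewrite (step_deterministic (machine_valid D k c n) st st1).
  exact: clos_rt1n_rt.
- by right.
- by move=> pos b; rewrite ne; exact: (dead_stuck pos b stuck).
Qed.

(** * The code of the transducer *)

Lemma code_ord m (i : 'I_m) : code_fin i = i.
Proof. by rewrite /code_fin enum_rank_ord. Qed.

Lemma code_unit (u : unit) : code_fin u = 0.
Proof.
have := ltn_ord (enum_rank u); rewrite [X in _ < X]card_unit.
by rewrite ltnS leqn0 => /eqP.
Qed.

Lemma enum_empty (T : finType) : #|T| = 0 -> enum T = [::].
Proof. by rewrite cardE; apply: size0nil. Qed.

Definition code_raw k (r : raw k) : nat :=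
  pr (r_src r) (pr (code_tag (r_tag r)) (pr (code_fml (r_test r))
    (pr (r_dst r) (pr (code_ffun (@code_fin _) (r_dvar r))
      (pr 0 (code_move (r_move r))))))).

(** The bounds make [inord] harmless on both states, and an assignment to an empty set of string
    variables has code 0. *)
Lemma code_trans_of k m (r : raw k) : r_src r <= m -> r_dst r <= m ->
  code_trans (trans_of m r) = code_raw r.
Proof.
move=> hs hd; rewrite /code_trans /code_raw /= !code_ord !inordK //.
by rewrite /code_ffun (enum_empty card_void).
Qed.

Lemma gadgets_dst k B c e x g : ent (e + size_cmd c) <= B -> x <= B ->
  List.In g (gadgets k c e x) ->
  [/\ b_dst (g_yes g) <= B, b_dst (g_no g) <= B & g_end g <= B].
Proof.
elim: c e x => [r|r|r|r r'|c1 IH1 c2 IH2|r c1 IH1 c2 IH2|r c1 IH1] e x /=;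
  rewrite /ent /scan.
1-4: by move=> he hx [<-|//] /=; split; lia.
- move=> he hx /In_cat [|]; [apply: IH1|apply: IH2]; rewrite /ent; lia.
- move=> he hx [<-|/In_cat []]; first by split=> /=; lia.
  + by apply: IH1; rewrite /ent; lia.
  + by apply: IH2; rewrite /ent; lia.
- move=> he hx [<-|]; first by split=> /=; lia.
  by apply: IH1; rewrite /ent; lia.
Qed.

Lemma prog_dst k c g : List.In g (prog k c) ->
  [/\ b_dst (g_yes g) <= base k c, b_dst (g_no g) <= base k c
    & g_end g <= base k c].
Proof.
rewrite /base size_prog /prog -cats1; move=> [<-|[<-|/In_cat [|]]].
- by split=> /=; rewrite /ent /scan; lia.
- by split=> /=; rewrite /ent /scan; lia.
- by apply: gadgets_dst; rewrite /ent; lia.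
- by move=> [<-|//]; split=> /=; rewrite /ent; lia.
Qed.

Lemma raws_gadget_dst k i g (r : raw k) B : List.In r (raws_gadget i g) ->
  scan i <= B -> b_dst (g_yes g) <= B -> b_dst (g_no g) <= B -> g_end g <= B ->
  r_dst r <= B.
Proof.
by move=> /= [<-|[<-|[<-|[<-|[<-|[<-|//]]]]]] /=; rewrite /ent /scan; lia.
Qed.

Lemma raws_dst k c n (r : raw k) : List.In r (raws k c n) ->
  r_dst r <= (base k c + n).+1.
Proof.
case/rawsP=> [->|i hi ->|p1 g p2 e h].
- by rewrite [r_dst _]/=; lia.
- by case: i hi => [|i] hi; rewrite [r_dst _]/= /base /ent; lia.
- have [|h1 h2 h3] := @prog_dst k c g.
    by rewrite e; apply/In_cat; right; left.
  have : size p1 < size (prog k c) by rewrite e size_cat /=; lia.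
  move=> lt; apply: (raws_gadget_dst h); try lia.
  by rewrite /base /ent /scan; lia.
Qed.

Lemma code_raws k c n m : (base k c + n).+1 <= m ->
  code_seq (@code_trans _ _ _ _ _) (map (trans_of m) (raws k c n)) =
  code_seq (@code_raw k) (raws k c n).
Proof.
move=> hm.
have : forall r, List.In r (raws k c n) -> r_src r <= m /\ r_dst r <= m.
  by move=> r h; have := raws_src h; have := raws_dst h; lia.
elim: (raws k c n) => //= r l IH h.
rewrite IH; last by move=> r' h'; apply: h; right.
by have [h1 h2] := h r (or_introl erefl); rewrite code_trans_of.
Qed.

(* The part of the code of [machine k c n] that does not depend on [n]. *)
Definition self k c : nat :=
  pr (base k c) (pr k (pr (code_ffun (@code_fin _) (setall k))
    (code_seq (@code_raw k) (raws0 k c)))).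

Fixpoint zeros (j : nat) : nat := if j is i.+1 then (pr 0 (zeros i)).+1 else 0.

Lemma code_seq0 T (f : T -> nat) s : (forall x, f x = 0) ->
  code_seq f s = zeros (size s).
Proof. by move=> f0; elim: s => //= x s ->; rewrite f0. Qed.

(* Here [n] stands for some [self k c]. *)
Section Reduction.
Variable n : nat.
Let M := unl n.
Let dv := unl (unr (unr n)).

(** Code of a transition that sets every data variable to [cur] and moves right: [pr 0 0] is the
    test [FTrue], and the final 2 is the move. The tag [tg] is 2 for a letter and 0 for the left
    end. *)
Definition load_code (src tg dst : nat) : nat :=
  pr src (pr tg (pr (pr 0 0) (pr dst (pr dv (pr 0 2))))).

Fixpoint chain_code (i : nat) : nat :=
  if i is j.+1
  then (pr (load_code (M + i) 2 (M + j)) (chain_code j)).+1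
  else unr (unr (unr n)).

Definition reduction : nat :=
  pr 1 (pr 0 (pr (M + n).+2 (pr (unl (unr n)).+3 (pr 0 (pr
    (pr (M + n).+1 (pr 0 (pr 0 (pr (zeros (M + n).+2)
      (pr (load_code (M + n).+1 0 (M + n)) (chain_code n)).+1))))
    0))))).

End Reduction.

(** The diagonal point: the number loaded by the machine describes that machine, and the code is a
    function of this number alone. *)
Lemma code_machine d (D : orderType d) k c :
  let n := self k c in
  code_instance (Instance (inord 0) (machine_valid D k c n)) = reduction n.
Proof.
move=> n; have M : unl n = base k c by rewrite unlK.
have K : unl (unr n) = k by rewrite unrK unlK.
have dv : unl (unr (unr n)) = code_ffun (@code_fin _) (setall k).
  by rewrite !unrK unlK.
have R : unr (unr (unr n)) = code_seq (@code_raw k) (raws0 k c).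
  by rewrite !unrK.
(* From here on [n] is used through its four components only. *)
clearbody n.
have chain i : code_seq (@code_raw k) (raws_chain k c i) = chain_code n i.
  elim: i => [|i IH]; first by rewrite /= R.
  by rewrite /= -/(base k c) IH /load_code M dv /code_raw /= code_unit.
rewrite /code_instance /reduction M K.
cbn [i_Sig i_Gam i_Q i_V i_X i_2dst i_target].
rewrite card_unit card_void !card_ord !code_ord inordK //.
rewrite /code_pre2dst; cbn [init curr final out delta machine].
rewrite code_raws // !code_ord inordK //.
congr (pr _ (pr _ (pr _ (pr _ (pr _ (pr (pr _ (pr _ (pr _ (pr _ _)))) _)))))).
- by rewrite finset.enum_set0.
- rewrite /code_ffun (@code_seq0 _ _ _) ?size_enum_ord // => q.
  by rewrite ffunE.
- by rewrite -chain /load_code dv.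
Qed.

Lemma repr_add F G :
  representable F -> representable G -> representable (fun a => F a + G a).
Proof.
move=> hF hG.
apply: (@repr_rec F (fun z => (unr (unr z)).+1) (fun a i => F a + i) G) => //.
- exact/repr_S/repr_unr/repr_unr/repr_id.
- by move=> a; rewrite addn0.
- by move=> a i; rewrite !unrK addnS.
Qed.

Ltac repr := repeat first
  [ assumption | apply: repr_id | apply: repr_const | apply: repr_pr
  | apply: repr_add | apply: repr_S | apply: repr_unl | apply: repr_unr ].

Lemma repr_zeros F : representable F -> representable (fun a => zeros (F a)).
Proof.
move=> hF.
apply: (@repr_rec (fun=> 0) (fun z => (pr 0 (unr (unr z))).+1)
  (fun _ i => zeros i)) => //; repr.
by move=> a i; rewrite !unrK.
Qed.

Lemma repr_reduction : representable reduction.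
Proof.
have h1 : representable (fun n => chain_code n n).
  (* The argument [z] of [G] packs the parameter, the index and the previous value. The parameter is
     also the bound of the recursion. *)
  pose i z := unl (unr z).
  pose G z := (pr (load_code (unl z) (unl (unl z) + (i z).+1) 2
    (unl (unl z) + i z)) (unr (unr z))).+1.
  apply: (@repr_rec (fun n => unr (unr (unr n))) G);
    rewrite /G /i /load_code; repr.
  + by [].
  + by move=> a j /=; rewrite !unrK !unlK.
have h2 : representable (fun n => zeros (unl n + n).+2).
  by apply: repr_zeros; repr.
by rewrite /reduction /load_code; repr.
Qed.

Theorem theorem3 (d : Order.disp_t) (D : orderType d)
  (D_infinite : infinite_set [set: D]%classic) :
  undecidable (@code_instance d D) (@reachable d D).
Proof.
move=> [p hp]; have [q hq] := repr_reduction.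
(* [c] computes the answer of [p] on [reduction n], the code of the machine that loads [n] and runs
   [c]. *)
pose c := compile (RComp p q) 0; pose n := self (regs c) c.
have [b cb] := hp (Instance (inord 0) (machine_valid D (regs c) c n)).
rewrite code_machine in cb.
have [N [s' [he [e0 _]]]] :=
  compileP (x := 0) (s := start n) (CComp (hq n) cb) erefl.
have := machine_correct D_infinite he (leqnn _); rewrite e0 /reachable /= => ->.
(* The simulation makes the target reachable iff [b] is false, the decision procedure iff [b] is
   true. *)
by case: b {cb e0} => -[h1 h2]; [have := h2 isT | have := h1 erefl].
Qed.
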